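(* For every $n\in\mathbb{N}$ there exists a constant $C=C(n)>0$ such that for every $d>n$ and every $S\subset\mathbb{R}^d$, $$\beta(x,r)\le C\,\min\left\{\frac{\sqrt{\mathsf{b}(x,r)}}{V_n},\,V_n^{1/n}\right\}\qquad\text{for every }x\in S,\ r>0,$$ where $$V_n=V_n(x,r):=\sup_{\{x_i\}_{i=0}^n\subset S\cap B_r(x)}r^{-n}\,\mathsf{Vol}_n(x_0,\dots,x_n).$$ In particular, for every $x\in S$ and $r>0$ with $\alpha(x,r)<1/8$, $$\beta(x,r)\le 100\,C\sqrt{\mathsf{b}(x,r)}.$$
   Context: $\mathbb{N}=\{1,2,\dots\}$. $B_r(x)$ denotes the open Euclidean ball in $\mathbb{R}^d$, and $B^{\mathbb{R}^n}_r(0)$ the open Euclidean ball in $\mathbb{R}^n$. $\mathsf{d}_H$ is the Hausdorff distance between subsets of $\mathbb{R}^d$, and $\mathsf{d}(y,\Gamma)$ is the Euclidean distance from a point $y$ to an affine plane $\Gamma$. For points $x_0,\dots,x_n\in\mathbb{R}^d$, $\mathsf{Vol}_n(x_0,\dots,x_n)$ is the $n$-dimensional volume of the simplex with vertices $x_0,\dots,x_n$ (equal to $0$ if the points are affinely dependent). If $V_n=0$, the quotient $\sqrt{\mathsf{b}(x,r)}/V_n$ is interpreted as $+\infty$, so that the minimum is $V_n^{1/n}=0$. For $\delta>0$, a map $f:X_1\to X_2$ between metric spaces $(X_1,\mathsf{d}_1),(X_2,\mathsf{d}_2)$ (not assumed continuous) is a $\delta$-isometry if $|\mathsf{d}_2(f(x),f(y))-\mathsf{d}_1(x,y)|<\delta$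 for all $x,y\in X_1$. For $S\subset\mathbb{R}^d$, $n<d$, $x\in S$ and $r>0$ set $$\alpha(x,r):=r^{-1}\inf_{\Gamma}\mathsf{d}_H(S\cap B_r(x),\Gamma\cap B_r(x)),\qquad \beta(x,r):=r^{-1}\inf_{\Gamma}\sup_{y\in S\cap B_r(x)}\mathsf{d}(y,\Gamma),$$ where both infima are over all $n$-dimensional affine planes $\Gamma\subset\mathbb{R}^d$ containing $x$, and $$\mathsf{b}(x,r):=r^{-1}\inf\{\delta>0:\ \text{there exists a }\delta\text{-isometry } f:S\cap B_r(x)\to B^{\mathbb{R}^n}_r(0)\},$$ where both sets are endowed with the Euclidean distance. *)

(* Defs.v *)
From HB Require Import structures.
From mathcomp Require Import all_boot all_order all_algebra.
From mathcomp Require Import all_classical all_reals all_analysis.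

Set Implicit Arguments.
Unset Strict Implicit.
Unset Printing Implicit Defensive.

Import Order.TTheory GRing.Theory Num.Theory.
Local Open Scope classical_set_scope.
Local Open Scope ring_scope.

(* The canonical norm and metric of 'rV[R]_d in MathComp-Analysis are those of
   the sup norm, hence the explicit Euclidean versions below. *)
Definition eucl_norm (R : realType) (d : nat) (v : 'rV[R]_d) : R :=
  Num.sqrt (\sum_(i < d) v ord0 i ^+ 2).

Definition eucl_dist (R : realType) (d : nat) (x y : 'rV[R]_d) : R :=
  eucl_norm (x - y).

Definition eucl_ball (R : realType) (d : nat) (x : 'rV[R]_d) (r : R) :
    set 'rV[R]_d :=
  [set y | eucl_dist x y < r].

(* Infima and suprema are taken in \bar R, so that they need no side
   conditions. *)
Definition dist_to_set (R : realType) (d : nat) (y : 'rV[R]_d)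
    (A : set 'rV[R]_d) : \bar R :=
  ereal_inf [set (eucl_dist y a)%:E | a in A].

Definition hausdorff_dist (R : realType) (d : nat) (A B : set 'rV[R]_d) :
    \bar R :=
  maxe (ereal_sup [set dist_to_set a B | a in A])
       (ereal_sup [set dist_to_set b A | b in B]).

Definition affine_plane (R : realType) (d n : nat) (G : set 'rV[R]_d) : Prop :=
  exists (p : 'rV[R]_d) (W : {vspace 'rV[R]_d}),
    \dim W = n /\ G = [set y | y - p \in W].

Definition planes_through (R : realType) (d n : nat) (x : 'rV[R]_d) :
    set (set 'rV[R]_d) :=
  [set G | affine_plane n G /\ G x].

(* f is a map between the subsets A and B of T1 and T2, carrying the metrics
   d1 and d2; its values outside A are irrelevant. *)
Definition delta_isometry (R : realType) (T1 T2 : Type) (d1 : T1 -> T1 -> R)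
    (d2 : T2 -> T2 -> R) (delta : R) (A : set T1) (B : set T2)
    (f : T1 -> T2) : Prop :=
  set_fun A B f /\
  forall x y : T1, A x -> A y -> `|d2 (f x) (f y) - d1 x y| < delta.

Definition alpha_nb (R : realType) (d n : nat) (S : set 'rV[R]_d)
    (x : 'rV[R]_d) (r : R) : \bar R :=
  ((r^-1)%:E * ereal_inf
    [set hausdorff_dist (S `&` eucl_ball x r) (G `&` eucl_ball x r)
      | G in planes_through n x])%E.

Definition beta_nb (R : realType) (d n : nat) (S : set 'rV[R]_d)
    (x : 'rV[R]_d) (r : R) : \bar R :=
  ((r^-1)%:E * ereal_inf
    [set ereal_sup [set dist_to_set y G | y in S `&` eucl_ball x r]
      | G in planes_through n x])%E.

Definition b_nb (R : realType) (d n : nat) (S : set 'rV[R]_d)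
    (x : 'rV[R]_d) (r : R) : \bar R :=
  ((r^-1)%:E * ereal_inf
    [set delta%:E | delta in
      [set delta : R | (0 < delta)%R /\
        exists f : 'rV[R]_d -> 'rV[R]_n,
          delta_isometry (@eucl_dist R d) (@eucl_dist R n) delta
            (S `&` eucl_ball x r) (eucl_ball 0 r) f]])%E.

(* The parallelotope spanned by the rows of an n x d matrix E has
   n-dimensional volume sqrt (det (E E^T)) (Gram); the simplex with the same
   edges at a vertex has 1 / n! of that volume. *)
Definition edge_mx (R : realType) (d n : nat) (p : 'I_n.+1 -> 'rV[R]_d) :
    'M[R]_(n, d) :=
  \matrix_(i < n, j < d) (p (lift ord0 i) - p ord0) ord0 j.

Definition simplex_vol (R : realType) (d n : nat) (p : 'I_n.+1 -> 'rV[R]_d) :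
    R :=
  Num.sqrt (\det (edge_mx p *m (edge_mx p)^T)) / (n`!)%:R.

Definition max_simplex_vol (R : realType) (d n : nat) (S : set 'rV[R]_d)
    (x : 'rV[R]_d) (r : R) : \bar R :=
  ereal_sup [set (r ^- n * simplex_vol p)%:E |
    p in [set p : 'I_n.+1 -> 'rV[R]_d |
      forall i, (S `&` eucl_ball x r) (p i)]].

(* sqrt b / V, read as +oo when V = 0, whatever b is; in \bar R, 0 / 0 would
   be 0. *)
Definition sqrt_quot (R : realType) (b V : \bar R) : \bar R :=
  (if V == 0 then +oo else sqrte b / V)%E.

(* Main.v *)
Require Import Defs.
From HB Require Import structures.
From mathcomp Require Import all_boot all_order all_algebra.
From mathcomp Require Import all_classical all_reals all_analysis.
From mathcomp Require Import perm ring lra.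

Import Order.TTheory GRing.Theory Num.Theory.
Local Open Scope classical_set_scope.
Local Open Scope ring_scope.

(* Adding an edge to a simplex multiplies its Gram determinant by the squared
   distance of the new edge to the span of the others. If beta > t, no plane of
   dimension at most n through x is t r-close to S, so a simplex with vertex x
   can be built greedily with all heights at least t r; hence t^n <= n! V_n. The
   same construction bounds V_n from below when alpha < 1/8.

   For the bound by b, the inner products of the edges are determined by the
   mutual distances, so a delta-isometry changes the Gram determinant of n + 1
   edges by O(delta r^(2n+1)). In R^n that determinant vanishes, so for a
   simplex of n edges in S the squared distance of any point of S to its plane,
   times the squared volume, is O(delta r^(2n+1)). *)

(** * Euclidean norm and distance *)

Section Euclidean.
Set Implicit Arguments.
Unset Strict Implicit.
Context {R : realType}.

Lemma eucl_norm_ge0 d (v : 'rV[R]_d) : 0 <= eucl_norm v.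
Proof. exact: sqrtr_ge0. Qed.

Lemma eucl_norm_sqr d (v : 'rV[R]_d) :
  eucl_norm v ^+ 2 = \sum_(i < d) v ord0 i ^+ 2.
Proof. by rewrite sqr_sqrtr// sumr_ge0// => i _; rewrite sqr_ge0. Qed.

Lemma eucl_norm0 d : eucl_norm (0 : 'rV[R]_d) = 0.
Proof.
by apply/eqP; rewrite -sqrf_eq0 eucl_norm_sqr big1// => i _; rewrite mxE expr0n.
Qed.

Lemma eucl_norm_eq0 d (v : 'rV[R]_d) : (eucl_norm v == 0) = (v == 0).
Proof.
apply/idP/eqP => [|->]; last by rewrite eucl_norm0.
rewrite -sqrf_eq0 eucl_norm_sqr psumr_eq0 => [|i _]; last exact: sqr_ge0.
move=> /allP h; apply/rowP => i; rewrite mxE; apply/eqP; rewrite -sqrf_eq0.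
by apply: h; rewrite mem_index_enum.
Qed.

Lemma eucl_normZ d a (v : 'rV[R]_d) : eucl_norm (a *: v) = `|a| * eucl_norm v.
Proof.
rewrite /eucl_norm -sqrtr_sqr -sqrtrM ?sqr_ge0// mulr_sumr.
by congr Num.sqrt; apply: eq_bigr => i _; rewrite mxE exprMn.
Qed.

Lemma eucl_normN d (v : 'rV[R]_d) : eucl_norm (- v) = eucl_norm v.
Proof. by rewrite -scaleN1r eucl_normZ normrN1 mul1r. Qed.

Lemma eucl_distC d (v w : 'rV[R]_d) : eucl_dist v w = eucl_dist w v.
Proof. by rewrite /eucl_dist -eucl_normN opprB. Qed.

Lemma mulmx_tr_norm d (v : 'rV[R]_d) :
  (v *m v^T) ord0 ord0 = eucl_norm v ^+ 2.
Proof. by rewrite eucl_norm_sqr mxE; apply: eq_bigr => i _; rewrite mxE expr2. Qed.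

Lemma eucl_norm_addr_sqr d (v w : 'rV[R]_d) : v *m w^T = 0 ->
  eucl_norm (v + w) ^+ 2 = eucl_norm v ^+ 2 + eucl_norm w ^+ 2.
Proof.
move=> vw; have wv : w *m v^T = 0 by rewrite -[LHS]trmxK trmx_mul trmxK vw trmx0.
rewrite -!mulmx_tr_norm linearD /= mulmxDl !mulmxDr vw wv addr0 add0r.
by rewrite mxE.
Qed.

Lemma eucl_normD_sqr_le d (v w : 'rV[R]_d) :
  eucl_norm (v + w) ^+ 2 <= 2 * (eucl_norm v ^+ 2 + eucl_norm w ^+ 2).
Proof.
rewrite !eucl_norm_sqr -big_split /= mulr_sumr; apply: ler_sum => i _.
by rewrite mxE; have := sqr_ge0 (v ord0 i - w ord0 i); nra.
Qed.

(** The bound [|v + w|^2 <= 2 (|v|^2 + |w|^2)] stands in for the triangle inequality. It gives the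
    same constant because both distances to the centre are below [r]. *)
Lemma eucl_ball_dist_le d (x y z : 'rV[R]_d) (r : R) : 0 < r ->
  eucl_ball x r y -> eucl_ball x r z -> eucl_dist y z <= 2 * r.
Proof.
move=> r0 xy xz; have r0' := ltW r0.
have -> : eucl_dist y z = eucl_norm ((x - z) + (y - x)).
  by rewrite /eucl_dist; congr eucl_norm; rewrite [RHS]addrC addrA subrK.
rewrite -ler_sqr ?nnegrE ?eucl_norm_ge0 ?mulr_ge0//.
apply: le_trans (eucl_normD_sqr_le _ _) _.
have h1 : eucl_norm (x - z) ^+ 2 <= r ^+ 2.
  by rewrite ler_sqr ?nnegrE ?eucl_norm_ge0// ltW.
have h2 : eucl_norm (y - x) ^+ 2 <= r ^+ 2.
  by rewrite -/(eucl_dist _ _) eucl_distC ler_sqr ?nnegrE ?eucl_norm_ge0// ltW.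
nra.
Qed.

Lemma polarization d (v w : 'rV[R]_d) : \sum_j v ord0 j * w ord0 j =
  (eucl_norm v ^+ 2 + eucl_norm w ^+ 2 - eucl_norm (v - w) ^+ 2) / 2.
Proof.
rewrite !eucl_norm_sqr -big_split /= -sumrB mulr_suml; apply: eq_bigr => j _.
by rewrite !mxE; field.
Qed.

End Euclidean.

(** * Gram determinants: heights, perturbation and rank *)

Section Gram.
Set Implicit Arguments.
Unset Strict Implicit.
Context {R : realType}.

(** Here [c *m E] is the orthogonal projection of [v] to the row span of [E]. Replacing [v] by its
    orthogonal part is a row operation of determinant 1, and makes the Gram matrix block
    diagonal. *)
Lemma det_gram_col m d (E : 'M[R]_(m, d)) (v : 'rV[R]_d) :
  \det (E *m E^T) != 0 ->
  exists c : 'rV[R]_m, \det (col_mx v E *m (col_mx v E)^T) =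
    eucl_norm (v - c *m E) ^+ 2 * \det (E *m E^T).
Proof.
move=> D0; have uG : E *m E^T \in unitmx by rewrite unitmxE unitfE.
exists (v *m E^T *m invmx (E *m E^T)).
set c := _ *m invmx _; set u := v - c *m E.
have uE : u *m E^T = 0.
  by rewrite mulmxBl -(mulmxA c) mulmxKV// subrr.
have Eu : E *m u^T = 0 by rewrite -[LHS]trmxK trmx_mul trmxK uE trmx0.
have -> : col_mx v E = block_mx 1%:M c 0 1%:M *m col_mx u E.
  by rewrite mul_block_col !mul1mx mul0mx add0r subrK.
rewrite trmx_mul mulmxA -(mulmxA (block_mx _ _ _ _)) !det_mulmx det_tr.
rewrite det_ublock !det1 !mul1r mulr1 tr_col_mx mul_col_row uE Eu det_ublock.
by rewrite det_mx11 mulmx_tr_norm.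
Qed.

(** Each new row contributes a factor at least [t ^+ 2]. The determinant so far stays positive, so
    the height formula applies again at the next step. *)
Lemma gram_greedy d (A : set 'rV[R]_d) (t : R) n : 0 < t ->
  (forall k (E : 'M[R]_(k, d)), (k < n)%N ->
    exists2 v, A v & forall c, t <= eucl_norm (v - c *m E)) ->
  exists2 E : 'M[R]_(n, d), (forall i, A (row i E)) &
    t ^+ (2 * n) <= \det (E *m E^T).
Proof.
move=> t0; elim: n => [|n IH] hA.
  by exists 0; [case|rewrite det_mx00].
have [|E AE tE] := IH; first by move=> k E kn; apply: hA; rewrite ltnW.
have D0 : 0 < \det (E *m E^T) by apply: lt_le_trans tE; rewrite exprn_gt0.
have [v Av vE] := hA _ E (ltnSn n).
have [c hc] := det_gram_col v (lt0r_neq0 D0).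
exists (col_mx v E : 'M[R]_(1 + n, d)).
  suff: forall i : 'I_(1 + n), A (row i (col_mx v E)) by [].
  move=> i; rewrite -(splitK i); case: (fintype.split i) => j /=.
    by rewrite rowKu row_id.
  by rewrite rowKd.
rewrite [X in _ <= X]hc mulnS exprD; apply: ler_pM => //.
- by rewrite exprn_ge0 ?ltW.
- by rewrite exprn_ge0 ?ltW.
- by rewrite ler_sqr ?nnegrE ?eucl_norm_ge0// ltW.
Qed.

(** Telescoping: exchanging one factor at a time costs [e] times [m - 1] factors bounded by [B]. For
    [m = 0] the coefficient [m%:R] vanishes. *)
Lemma ler_norm_prodB m (a b : 'I_m -> R) (B e : R) :
  (forall i, `|a i| <= B) -> (forall i, `|b i| <= B) ->
  (forall i, `|a i - b i| <= e) ->
  `|\prod_i a i - \prod_i b i| <= m%:R * B ^+ m.-1 * e.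
Proof.
elim: m a b => [|m IH] a b aB bB ab.
  by rewrite !big_ord0 subrr normr0 !mul0r.
have B0 : 0 <= B by apply: le_trans (aB ord0); rewrite normr_ge0.
rewrite !big_ord_recl.
set P := \prod_(i < m) a _; set Q := \prod_(i < m) b _.
have -> : a ord0 * P - b ord0 * Q = a ord0 * (P - Q) + (a ord0 - b ord0) * Q.
  by ring.
apply: le_trans (ler_normD _ _) _; rewrite !normrM.
have h1 : `|P - Q| <= m%:R * B ^+ m.-1 * e by apply: IH.
have h2 : `|Q| <= B ^+ m.
  rewrite normr_prod -[m in B ^+ m]card_ord -prodr_const.
  by apply: ler_prod => i _; rewrite normr_ge0 bB.
have -> : m.+1%:R * B ^+ m.+1.-1 * e = B * (m%:R * B ^+ m.-1 * e) + e * B ^+ m.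
  rewrite -(natr1 m) /=; case: m {IH a b aB bB ab P Q h1 h2} => [|m] /=.
    by rewrite expr0; ring.
  by rewrite exprS; ring.
by rewrite lerD// ler_pM.
Qed.

Lemma ler_norm_det m (M : 'M[R]_m) (B : R) : (forall i j, `|M i j| <= B) ->
  `|\det M| <= m`!%:R * B ^+ m.
Proof.
move=> MB; apply: le_trans (ler_norm_sum _ _ _) _.
rewrite -card_Sn mulr_natl -sumr_const; apply: ler_sum => s _.
rewrite normrM normrX normrN1 expr1n mul1r normr_prod.
rewrite -[m in B ^+ m]card_ord -prodr_const.
by apply: ler_prod => i _; rewrite normr_ge0 MB.
Qed.

(** The two Leibniz expansions are compared permutation by permutation, with equal signs. *)
Lemma ler_norm_detB m (M N : 'M[R]_m) (B e : R) :
  (forall i j, `|M i j| <= B) -> (forall i j, `|N i j| <= B) ->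
  (forall i j, `|M i j - N i j| <= e) ->
  `|\det M - \det N| <= m`!%:R * (m%:R * B ^+ m.-1 * e).
Proof.
move=> MB NB MN; rewrite -sumrB; apply: le_trans (ler_norm_sum _ _ _) _.
rewrite -card_Sn mulr_natl -sumr_const; apply: ler_sum => s _.
by rewrite -mulrBr normrM normrX normrN1 expr1n mul1r ler_norm_prodB.
Qed.

(** An invertible Gram matrix would have rank [m], but its rank is at most that of [E], hence at
    most [d]. *)
Lemma det_gram_eq0 m d (E : 'M[R]_(m, d)) : (d < m)%N -> \det (E *m E^T) = 0.
Proof.
move=> dm; apply/eqP; apply/negPn/negP => D0.
have uG : E *m E^T \in unitmx by rewrite unitmxE unitfE.
have := mxrankM_maxl E E^T; rewrite mxrank_unit// => h.
by have := leq_trans h (rank_leq_col E); rewrite leqNgt dm.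
Qed.

(** Polarization expresses Gram entries through lengths and mutual distances only, the data that a
    [delta]-isometry nearly preserves. *)
Lemma gramE m d (a : 'I_m -> 'rV[R]_d) (E : 'M[R]_(m, d)) i j :
  (forall i, row i E = a i) -> (E *m E^T) i j =
  (eucl_norm (a i) ^+ 2 + eucl_norm (a j) ^+ 2 - eucl_norm (a i - a j) ^+ 2) / 2.
Proof.
move=> rE; rewrite -polarization mxE; apply: eq_bigr => k _.
by rewrite -!rE !mxE.
Qed.

Lemma gram_entry_bound (m e : nat) (r : R) (a : 'I_m -> 'rV[R]_e) (E : 'M[R]_(m, e))
    i j : 0 <= r ->
  (forall i, row i E = a i) -> (forall i, eucl_norm (a i) <= 2 * r) ->
  (forall i j, eucl_norm (a i - a j) <= 2 * r) ->
  `|(E *m E^T) i j| <= 4 * r ^+ 2.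
Proof.
move=> r0 rE ai aij; rewrite (gramE _ _ rE).
have sq e' (v : 'rV[R]_e') : eucl_norm v <= 2 * r ->
    0 <= eucl_norm v ^+ 2 <= 4 * r ^+ 2.
  move=> h; rewrite sqr_ge0 (_ : 4 * _ = (2 * r) ^+ 2); last by ring.
  by rewrite ler_sqr// ?nnegrE ?eucl_norm_ge0// mulr_ge0.
have := sq _ _ (ai i); have := sq _ _ (ai j); have := sq _ _ (aij i j).
by rewrite ler_norml; lra.
Qed.

Lemma edge_mx_row d n (p : 'I_n.+1 -> 'rV[R]_d) i :
  row i (edge_mx p) = p (lift ord0 i) - p ord0.
Proof. by apply/rowP => j; rewrite !mxE. Qed.

End Gram.

(** * Subspaces: extension, row spans, orthogonal vectors *)

Section Subspaces.
Set Implicit Arguments.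
Unset Strict Implicit.
Context {R : realType}.

(** Needed since [beta_nb] only sees planes of dimension exactly [n], while the edges chosen so far
    may span less. A vector outside the space is added until the dimension is [n]. *)
Lemma vspace_extend (d n : nat) (U : {vspace 'rV[R]_d}) :
  (\dim U <= n)%N -> (n <= d)%N ->
  exists2 W : {vspace 'rV[R]_d}, (U <= W)%VS & \dim W = n.
Proof.
elim: n => [|n IH]; first by rewrite leqn0 => /eqP dU _; exists U.
rewrite leq_eqVlt => /predU1P[dU _|dU nd]; first by exists U.
have [W UW dW] := IH dU (ltnW nd).
have /subvPn [v _ vW] : ~~ ({:'rV[R]_d} <= W)%VS.
  apply: contraL nd => /dimvS.
  by rewrite dimvf dim_matrix mul1r dW -leqNgt.
exists (W + <[v]>)%VS; first exact: subv_trans UW (addvSl _ _).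
rewrite dimv_disjoint_sum ?dW ?dim_vline.
  suff -> : v != 0 by rewrite addn1.
  by apply: contra vW => /eqP->; rewrite mem0v.
apply/eqP; rewrite -subv0; apply/subvP => w; rewrite memv_cap => /andP[wW].
move=> /vlineP[k wk]; rewrite memv0 wk; apply/eqP; move: wW; rewrite wk.
have [->|k0] := eqVneq k 0; first by rewrite scale0r.
by rewrite rpredZeq (negbTE k0) (negbTE vW).
Qed.

Definition row_span m d (E : 'M[R]_(m, d)) : {vspace 'rV[R]_d} :=
  <<[seq row i E | i <- enum 'I_m]>>%VS.

Lemma mulmx_row_span m d (c : 'rV[R]_m) (E : 'M[R]_(m, d)) :
  c *m E \in row_span E.
Proof.
rewrite mulmx_sum_row; apply: memv_suml => i _; apply: memvZ.
by apply: memv_span; apply/map_f; rewrite mem_enum.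
Qed.

Lemma dim_row_span_le m d (E : 'M[R]_(m, d)) : (\dim (row_span E) <= m)%N.
Proof. by apply: leq_trans (dim_span _) _; rewrite size_map size_enum_ord. Qed.

(** A linear relation among the rows is killed on the right by [E], hence by the invertible matrix
    [E *m E^T], so it is trivial. *)
Lemma dim_row_span m d (E : 'M[R]_(m, d)) :
  \det (E *m E^T) != 0 -> \dim (row_span E) = m.
Proof.
move=> D0; have uG : E *m E^T \in unitmx by rewrite unitmxE unitfE.
set s := [tuple row i E | i < m].
have -> : row_span E = span s by [].
suff /eqP : free s by rewrite size_tuple.
apply/freeP => k h i.
suff : (\row_j k j) = 0 by move=> /rowP/(_ i); rewrite !mxE.
have kE : (\row_j k j) *m E = 0.
  rewrite mulmx_sum_row -[RHS]h; apply: eq_bigr => j _.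
  by rewrite mxE -tnth_nth tnth_mktuple.
by rewrite -(mulmxK uG (\row_j k j)) mulmxA kE !mul0mx.
Qed.

(** Dimension count: orthogonality to [k] rows imposes [k < n] linear conditions on the coordinates
    in a basis of [W]. *)
Lemma orthogonal_vector (d n k : nat) (W : {vspace 'rV[R]_d})
    (E : 'M[R]_(k, d)) : \dim W = n -> (k < n)%N ->
  exists u, [/\ u \in W, u != 0 & E *m u^T = 0].
Proof.
move=> dW kn.
pose B : 'M[R]_(\dim W, d) := \matrix_(i < \dim W) (vbasis W)`_i.
have : kermx (B *m E^T) != 0.
  rewrite kermx_eq0 /row_free neq_ltn; apply/orP; left.
  by apply: leq_ltn_trans (rank_leq_col _) _; rewrite dW.
case/rowV0Pn => c /sub_kermxP cBE c0.
have cB : c *m B = \sum_i c ord0 i *: (vbasis W)`_i.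
  by rewrite mulmx_sum_row; apply: eq_bigr => i _; rewrite rowK.
exists (c *m B); split.
- rewrite cB; apply: memv_suml => i _; apply: memvZ; apply: vbasis_mem.
  by rewrite mem_nth// size_tuple.
- apply: contra c0 => /eqP; rewrite cB => h; apply/eqP/rowP => i; rewrite mxE.
  by have /freeP/(_ (c ord0) h i) := basis_free (vbasisP W).
- by rewrite -[LHS]trmxK trmx_mul trmxK -mulmxA cBE trmx0.
Qed.

End Subspaces.

(** * Elementary bounds and finiteness for beta, the volume and b *)

Section LocalQuantities.
Set Implicit Arguments.
Unset Strict Implicit.
Context {R : realType} {d : nat}.
Variables (n : nat) (S : set 'rV[R]_d) (x : 'rV[R]_d) (r : R).
Hypotheses (Sx : S x) (r0 : 0 < r).
Let A := S `&` eucl_ball x r.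

Lemma eucl_ball_center : eucl_ball x r x.
Proof. by rewrite /eucl_ball/= /eucl_dist subrr eucl_norm0. Qed.

Let Ax : A x. Proof. by split => //; exact: eucl_ball_center. Qed.

Let Adist y z : A y -> A z -> eucl_dist y z <= 2 * r.
Proof. by move=> [_ xy] [_ xz]; exact: eucl_ball_dist_le xy xz. Qed.

Lemma beta_nb_ge0 : (0 <= beta_nb n S x r)%E.
Proof.
apply: mule_ge0; first by rewrite lee_fin invr_ge0 ltW.
apply/ereal_infP => _ [G _ <-].
apply: le_ereal_sup_tmp; exists (dist_to_set x G); first by exists x.
by apply/ereal_infP => _ [a _ <-]; rewrite lee_fin eucl_norm_ge0.
Qed.

Lemma beta_nb_le (W : {vspace 'rV[R]_d}) h : \dim W = n ->
  (forall y, A y -> exists2 w, w \in W & eucl_norm (y - x - w) <= h) ->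
  (beta_nb n S x r <= (h / r)%:E)%E.
Proof.
move=> dW hW; rewrite /beta_nb lee_pdivrMl// -EFinM mulrCA divff ?gt_eqF// mulr1.
apply: ge_ereal_inf; eexists.
  exists [set y | y - x \in W] => //; split; last by rewrite /= subrr mem0v.
  by exists x, W.
apply/ereal_supP => _ [y Ay <-]; have [w wW yw] := hW y Ay.
apply: ge_ereal_inf; exists (eucl_dist y (w + x))%:E.
  by exists (w + x) => //=; rewrite addrK.
by rewrite lee_fin /eucl_dist opprD addrA addrAC.
Qed.

(** The contrapositive of [beta_nb_le], in the form that the greedy construction consumes. *)
Lemma beta_nb_far (W : {vspace 'rV[R]_d}) t : (t%:E < beta_nb n S x r)%E ->
  \dim W = n ->
  exists2 y, A y & forall w, w \in W -> t * r <= eucl_norm (y - x - w).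
Proof.
move=> tb dW; apply: contrapT => /forall2NP h; move: tb; apply/negP.
rewrite -leNgt -[t](mulfK (lt0r_neq0 r0)); apply: (beta_nb_le dW) => y Ay.
have [//|/existsNP[w /not_implyP[wW /negP]]] := h y.
by rewrite -ltNge => /ltW; exists w.
Qed.

Lemma max_simplex_vol_ge (E : 'M[R]_(n, d)) : (forall i, A (x + row i E)) ->
  ((r ^- n * (Num.sqrt (\det (E *m E^T)) / n`!%:R))%:E
    <= max_simplex_vol n S x r)%E.
Proof.
move=> AE; pose p i := oapp (fun j => x + row j E) x (unlift ord0 i).
apply: ereal_sup_ubound; exists p.
  by move=> i; rewrite /p; case: unliftP => [j|] _ //=; exact: AE.
rewrite /simplex_vol; suff -> : edge_mx p = E by [].
by apply/matrixP => i j; rewrite /p mxE liftK unlift_none/= !mxE addrAC subrr add0r.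
Qed.

Lemma max_simplex_vol_ge0 : (0 <= max_simplex_vol n S x r)%E.
Proof.
apply: le_trans (max_simplex_vol_ge (E := 0) _) => [|i]; last by rewrite linear0 addr0.
by rewrite lee_fin mulr_ge0 ?divr_ge0 ?invr_ge0 ?exprn_ge0 ?sqrtr_ge0// ltW.
Qed.

(** Edges have length at most [2 * r], so Gram entries are at most [4 * r ^+ 2] and the determinant
    is bounded uniformly. *)
Lemma max_simplex_vol_lty : (max_simplex_vol n S x r < +oo)%E.
Proof.
pose K := r ^- n * (Num.sqrt (n`!%:R * (4 * r ^+ 2) ^+ n) / n`!%:R).
apply: le_lt_trans (ltry K); apply/ereal_supP => _ [p Ap <-].
rewrite lee_fin ler_wpM2l ?invr_ge0 ?exprn_ge0 ?(ltW r0)//.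
rewrite ler_wpM2r ?invr_ge0// ler_wsqrtr//; apply: le_trans (ler_norm _) _.
apply: ler_norm_det => i j; apply: (gram_entry_bound _ _ (ltW r0) (edge_mx_row p)).
  by move=> k; apply: Adist; exact: Ap.
by move=> k l; rewrite opprB addrA subrK; apply: Adist; exact: Ap.
Qed.

Lemma b_nb_ge (c : R) :
  (forall delta f, 0 < delta -> delta_isometry (@eucl_dist R d) (@eucl_dist R n)
     delta A (eucl_ball 0 r) f -> c <= delta / r) ->
  (c%:E <= b_nb n S x r)%E.
Proof.
move=> h; rewrite /b_nb lee_pdivlMl//; apply/ereal_infP => _ [e [e0 [f fi]] <-].
by rewrite -EFinM lee_fin mulrC -ler_pdivlMr//; exact: h fi.
Qed.

(** The constant map to the origin changes distances by at most [2 * r]. The extra 1 makes the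
    inequality strict. *)
Lemma b_nb_lty : (b_nb n S x r < +oo)%E.
Proof.
apply: le_lt_trans (ltry (r^-1 * (2 * r + 1))); rewrite EFinM.
apply: lee_wpmul2l; first by rewrite lee_fin invr_ge0 ltW.
apply: ge_ereal_inf; exists (2 * r + 1)%:E => //.
have r2 : 0 <= 2 * r by rewrite mulr_ge0// ltW.
exists (2 * r + 1) => //; split; first by lra.
exists (fun=> 0); split.
  by move=> y _; rewrite /eucl_ball/= /eucl_dist subrr eucl_norm0.
move=> y z Ay Az; rewrite /eucl_dist subrr eucl_norm0 sub0r normrN.
by rewrite ger0_norm ?eucl_norm_ge0//; have := Adist Ay Az; rewrite /eucl_dist; lra.
Qed.

End LocalQuantities.

(** * Perturbation of the Gram determinant under a [delta]-isometry *)

Section GramPerturbation.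
Set Implicit Arguments.
Unset Strict Implicit.
Context {R : realType}.

(** By [a^2 - b^2 = (a - b) (a + b)] each square moves by at most [4 * delta * r]. Three squares,
    halved, give the factor 6. *)
Lemma polarization_perturb (u v w u' v' w' r delta : R) :
  0 <= u <= 2 * r -> 0 <= v <= 2 * r -> 0 <= w <= 2 * r ->
  0 <= u' <= 2 * r -> 0 <= v' <= 2 * r -> 0 <= w' <= 2 * r ->
  `|u' - u| < delta -> `|v' - v| < delta -> `|w' - w| < delta ->
  `|(u ^+ 2 + v ^+ 2 - w ^+ 2) / 2 - (u' ^+ 2 + v' ^+ 2 - w' ^+ 2) / 2|
    <= 6 * delta * r.
Proof.
have sq (a b : R) : 0 <= a <= 2 * r -> 0 <= b <= 2 * r -> `|b - a| < delta ->
    `|a ^+ 2 - b ^+ 2| <= 4 * delta * r.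
  move=> a2 b2 ab; rewrite subr_sqr normrM distrC.
  rewrite (_ : 4 * delta * r = delta * (4 * r)); last by ring.
  by apply: ler_pM => //; [exact: ltW|rewrite ger0_norm; lra].
move=> hu hv hw hu' hv' hw' du dv dw.
have := sq _ _ hu hu' du; have := sq _ _ hv hv' dv; have := sq _ _ hw hw' dw.
by rewrite !ler_norml; lra.
Qed.

(* Gram entries are at most [4 r^2] and differ by at most [6 delta r]; the rest
   comes from expanding the determinant. *)
Definition plane_const (n : nat) : R := n.+1`!%:R * (n.+1%:R * 4 ^+ n * 6).

Lemma delta_isometry_plane d n (A : set 'rV[R]_d) x r delta f
    (p : 'I_n.+1 -> 'rV[R]_d) y :
  0 < r -> A `<=` eucl_ball x r ->
  delta_isometry (@eucl_dist R d) (@eucl_dist R n) delta A (eucl_ball 0 r) f ->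
  (forall i, A (p i)) -> A y ->
  \det (edge_mx p *m (edge_mx p)^T) != 0 ->
  exists c : 'rV[R]_n,
    eucl_norm (y - p ord0 - c *m edge_mx p) ^+ 2 *
      \det (edge_mx p *m (edge_mx p)^T) <=
    plane_const n * delta * r ^+ (2 * n).+1.
Proof.
move=> r0 Ar [fA fd] Ap Ay D0.
have [c hc] := det_gram_col (y - p ord0) D0; exists c; rewrite -hc => {hc}.
(* [q] lists [y] and then the vertices other than [p ord0], so that [E] and [F] hold corresponding
   edges in the source and in the image. *)
pose q (i : 'I_(1 + n)) := match fintype.split i with
  inl _ => y | inr j => p (lift ord0 j) end.
have Aq i : A (q i) by rewrite /q; case: (fintype.split i).
pose E : 'M[R]_(1 + n, d) := col_mx (y - p ord0) (edge_mx p).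
pose F : 'M[R]_(1 + n, n) := \matrix_(i < 1 + n) (f (q i) - f (p ord0)).
have rE i : row i E = q i - p ord0.
  rewrite /q -[i in LHS]splitK; case: (fintype.split i) => j /=.
    by rewrite rowKu row_id.
  by rewrite rowKd edge_mx_row.
have rF i : row i F = f (q i) - f (p ord0) by rewrite rowK.
have dA a b : A a -> A b -> eucl_dist a b <= 2 * r.
  by move=> /Ar xa /Ar xb; exact: eucl_ball_dist_le xa xb.
have dF a b : A a -> A b -> eucl_dist (f a) (f b) <= 2 * r.
  by move=> /fA fa /fA fb; exact: eucl_ball_dist_le fa fb.
have subB e (a b o : 'rV[R]_e) : a - o - (b - o) = a - b.
  by rewrite opprB addrA subrK.
(* The [n + 1] image edges lie in dimension [n], so the source determinant equals its difference
   from that of the image. *)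
have F0 : \det (F *m F^T) = 0 by apply: det_gram_eq0.
apply: le_trans (ler_norm _) _; rewrite -[X in `|X|]subr0 -F0.
apply: le_trans (ler_norm_detB (B := 4 * r ^+ 2) (e := 6 * delta * r) _ _ _) _.
- move=> i j; apply: (gram_entry_bound _ _ (ltW r0) rE) => [k|k l].
    exact: dA.
  by rewrite subB; exact: dA.
- move=> i j; apply: (gram_entry_bound _ _ (ltW r0) rF) => [k|k l].
    exact: dF.
  by rewrite subB; exact: dF.
- move=> i j; rewrite (gramE _ _ rE) (gramE _ _ rF) !subB.
  by apply: polarization_perturb; rewrite ?eucl_norm_ge0 ?dA ?dF ?fd.
rewrite /plane_const exprMn -exprM exprS le_eqVlt; apply/orP; left; apply/eqP.
by rewrite add1n /=; ring.
Qed.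

End GramPerturbation.

(** * The two bounds on beta and the lower bound on the volume *)

Section Estimates.
Set Implicit Arguments.
Unset Strict Implicit.
Context {R : realType} {d n : nat}.
Variables (S : set 'rV[R]_d) (x : 'rV[R]_d) (r : R).
Hypotheses (n0 : (0 < n)%N) (nd : (n < d)%N) (Sx : S x) (r0 : 0 < r).
Let A := S `&` eucl_ball x r.

Lemma max_simplex_vol_greedy t : 0 < t ->
  (forall k (E : 'M[R]_(k, d)), (k < n)%N ->
    exists2 y, A y & forall c, t * r <= eucl_norm (y - x - c *m E)) ->
  ((t ^+ n / n`!%:R)%:E <= max_simplex_vol n S x r)%E.
Proof.
move=> t0 hA; have tr0 : 0 < t * r by rewrite mulr_gt0.
have [k E kn|E AE tE] := gram_greedy (A := [set v | A (x + v)]) (n := n) tr0.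
  by have [y Ay yE] := hA k E kn; exists (y - x) => //=; rewrite addrC subrK.
apply: le_trans (max_simplex_vol_ge Sx r0 AE).
rewrite lee_fin mulrA ler_wpM2r ?invr_ge0//.
rewrite mulrC ler_pdivlMr ?exprn_gt0// -exprMn.
rewrite -[leLHS]ger0_norm ?exprn_ge0 ?(ltW tr0)// -sqrtr_sqr ler_wsqrtr//.
by rewrite -exprM mulnC.
Qed.

Lemma beta_nb_pow_le t : 0 < t -> (t%:E < beta_nb n S x r)%E ->
  ((t ^+ n / n`!%:R)%:E <= max_simplex_vol n S x r)%E.
Proof.
move=> t0 tb; apply: max_simplex_vol_greedy => // k E kn.
have [||W EW dW] := @vspace_extend R d n (row_span E).
- exact: leq_trans (dim_row_span_le E) (ltnW kn).
- exact: ltnW.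
have [y Ay yW] := beta_nb_far r0 tb dW.
by exists y => // c; apply: yW; apply: (subvP EW); exact: mulmx_row_span.
Qed.

(** A [t] strictly between the bound and beta would give [t^n <= n! v], against
    [t^n > (n!)^n v >= n! v]. This also shows that beta is finite. *)
Lemma beta_nb_le_root (v : R) : max_simplex_vol n S x r = v%:E ->
  (beta_nb n S x r <= (n`!%:R * v `^ n%:R^-1)%:E)%E.
Proof.
move=> Vv; have v0 : 0 <= v.
  by rewrite -lee_fin -Vv; exact: max_simplex_vol_ge0.
set s := n`!%:R * _; have s0 : 0 <= s by rewrite mulr_ge0 ?powR_ge0.
rewrite leNgt; apply/negP => sb.
have [t st tb] : exists2 t, s < t & (t%:E < beta_nb n S x r)%E.
  case: (beta_nb n S x r) sb => [b| |//]; last by exists (s + 1); rewrite ?ltrDl ?ltry.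
  by rewrite lte_fin => sb; exists ((s + b) / 2); rewrite ?lte_fin; lra.
have t0 : 0 < t by exact: le_lt_trans st.
have := beta_nb_pow_le t0 tb; apply/negP; rewrite Vv lee_fin -ltNge.
rewrite ltr_pdivlMr ?ltr0n ?fact_gt0//.
have : s ^+ n < t ^+ n by rewrite ltr_pXn2r ?nnegrE// ltW.
apply: le_lt_trans.
rewrite exprMn -[X in _ <= _ * X]powR_mulrn ?powR_ge0// -powRrM mulVf ?pnatr_eq0 -?lt0n//.
rewrite powRr1// mulrC ler_wpM2r// -natrX ler_nat -{1}(expn1 n`!).
by rewrite leq_pexp2l ?fact_gt0.
Qed.

(* The vertices are chosen one at a time, each near a point of the plane that is
   orthogonal to the previous edges: points of S near a fixed orthogonal frame
   of the plane could be affinely dependent when n is large. *)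
Lemma alpha_nb_vol : (alpha_nb n S x r < (8^-1)%:E)%E ->
  ((2^-1 ^+ n / n`!%:R)%:E <= max_simplex_vol n S x r)%E.
Proof.
rewrite /alpha_nb lte_pdivrMl// -EFinM => /ereal_inf_ltP[_ [G [GP Gx] <-] GA].
case: GP => p [W [dW GE]]; subst G; apply: max_simplex_vol_greedy => // k E kn.
have [u [uW u0 Eu]] := orthogonal_vector E dW kn.
have nu0 : 0 < eucl_norm u by rewrite lt_neqAle eq_sym eucl_norm_eq0 u0 eucl_norm_ge0.
(* Length [7/8 r] keeps [w + x] inside the open ball, and a point of [A] lies within [r/8] of it.
   Then [49/64 <= 2 (h^2 + 1/64)] for the height [h r], so [h^2 >= 47/128 > 1/4]. *)
pose w := (7 / 8 * r / eucl_norm u) *: u.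
have nw : eucl_norm w = 7 / 8 * r.
  rewrite eucl_normZ ger0_norm ?divfK ?gt_eqF//.
  by rewrite divr_ge0 ?eucl_norm_ge0// mulr_ge0// ltW.
pose g := w + x.
have Gg : ([set y | y - p \in W] `&` eucl_ball x r) g.
  split=> /=; first by rewrite /g -addrA memvD// memvZ.
  rewrite /eucl_ball/= eucl_distC /eucl_dist addrK nw; move: r0; lra.
have : (dist_to_set g A < (r * 8^-1)%:E)%E.
  apply: le_lt_trans GA; rewrite /hausdorff_dist le_max; apply/orP; right.
  by apply: ereal_sup_ubound; exists g.
move=> /ereal_inf_ltP[_ [a Aa <-]]; rewrite lte_fin => ga.
exists a => // c.
have cw : w *m (- (c *m E))^T = 0.
  have Ew : E *m w^T = 0 by rewrite linearZ /= -scalemxAr Eu scaler0.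
  have wE : w *m E^T = 0 by rewrite -[LHS]trmxK trmx_mul trmxK Ew trmx0.
  by rewrite linearN /= trmx_mul mulmxN mulmxA wE mul0mx oppr0.
have := eucl_norm_addr_sqr cw; rewrite nw.
have -> : w - c *m E = (a - x - c *m E) + (g - a).
  by apply/rowP => j; rewrite !mxE; ring.
have := eucl_normD_sqr_le (a - x - c *m E) (g - a).
have h1 : eucl_norm (g - a) ^+ 2 <= (r * 8^-1) ^+ 2.
  by rewrite ler_sqr ?nnegrE ?eucl_norm_ge0 ?(ltW ga)// mulr_ge0// ltW.
have h2 : 0 <= eucl_norm (- (c *m E)) ^+ 2 by rewrite sqr_ge0.
move=> h3 h4; rewrite -ler_sqr ?nnegrE ?eucl_norm_ge0 ?mulr_ge0 ?(ltW r0)//.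
by have h5 := sqr_ge0 r; lra.
Qed.

Lemma plane_const_gt0 : 0 < plane_const n :> R.
Proof. by rewrite !mulr_gt0 ?exprn_gt0 ?ltr0n ?fact_gt0. Qed.

(** The plane of the simplex may miss [x], but [x] obeys the same distance bound as every other
    point. Translating the plane to [x] costs a factor 4 in squared distance. *)
Lemma beta_nb_isometry (B delta : R) f (p : 'I_n.+1 -> 'rV[R]_d) :
  beta_nb n S x r = B%:E -> 0 < delta ->
  delta_isometry (@eucl_dist R d) (@eucl_dist R n) delta A (eucl_ball 0 r) f ->
  (forall i, A (p i)) ->
  (B * (r ^- n * simplex_vol p)) ^+ 2 <= 4 * plane_const n * (delta / r).
Proof.
move=> BE delta0 fi Ap; rewrite /simplex_vol.
set D := \det _; have K0 := plane_const_gt0.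
(* A degenerate simplex has volume 0, and the left side vanishes. *)
have [D0|D0] := leP D 0.
  by rewrite ler0_sqrtr// mul0r !mulr0 expr0n/= ltW// !mulr_gt0 ?invr_gt0.
pose M := plane_const n * delta * r ^+ (2 * n).+1.
have M0 : 0 < M by rewrite !mulr_gt0 ?exprn_gt0.
have MD0 : 0 <= 4 * (M / D) by rewrite mulr_ge0// divr_ge0// ltW.
have rA : A `<=` eucl_ball x r by move=> y [].
have plane y : A y -> exists c : 'rV[R]_n,
    eucl_norm (y - p ord0 - c *m edge_mx p) ^+ 2 <= M / D.
  move=> Ay; have [c hc] := delta_isometry_plane r0 rA fi Ap Ay (lt0r_neq0 D0).
  by exists c; rewrite ler_pdivlMr.
have Ax : A x by split => //; exact: eucl_ball_center.
have [cx hx] := plane x Ax.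
have B0 : 0 <= B by rewrite -lee_fin -BE beta_nb_ge0.
have : (B%:E <= (Num.sqrt (4 * (M / D)) / r)%:E)%E.
  rewrite -BE; apply: (beta_nb_le r0 (dim_row_span (lt0r_neq0 D0))) => y Ay.
  (* The plane of the simplex, translated so as to contain x. *)
  have [cy hy] := plane y Ay; exists ((cy - cx) *m edge_mx p).
    exact: mulmx_row_span.
  rewrite -ler_sqr ?nnegrE ?eucl_norm_ge0 ?sqrtr_ge0// (sqr_sqrtr MD0).
  have -> : y - x - (cy - cx) *m edge_mx p =
      (y - p ord0 - cy *m edge_mx p) + (- (x - p ord0 - cx *m edge_mx p)).
    rewrite mulmxBl; apply/rowP => j; rewrite !mxE; ring.
  by apply: le_trans (eucl_normD_sqr_le _ _) _; rewrite eucl_normN; lra.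
rewrite lee_fin ler_pdivlMr// => Br.
have Br2 : (B * r) ^+ 2 <= 4 * (M / D).
  rewrite -(sqr_sqrtr MD0).
  by rewrite ler_sqr ?nnegrE ?sqrtr_ge0 ?mulr_ge0// ltW.
have f1 : 1 <= n`!%:R :> R by rewrite ler1n fact_gt0.
(* Both sides are written with the common factor [D / (r ^+ n.+1) ^+ 2]. What remains is [Br2] and
   [(n!)^-2 <= 1]. *)
have -> : (B * (r ^- n * (Num.sqrt D / n`!%:R))) ^+ 2 =
    (B * r) ^+ 2 * (D / (r ^+ n.+1) ^+ 2) * (n`!%:R ^- 2).
  rewrite !exprMn sqr_sqrtr ?(ltW D0)// (exprS r n); field.
  by rewrite !gt_eqF ?exprn_gt0 ?ltr0n ?fact_gt0.
have -> : 4 * plane_const n * (delta / r) =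
    4 * (M / D) * (D / (r ^+ n.+1) ^+ 2) * 1 :> R.
  have -> : (r ^+ n.+1) ^+ 2 = r * r ^+ (2 * n).+1.
    by rewrite -exprM -exprS mulnC mulnS.
  rewrite /M; set rn := r ^+ (2 * n).+1.
  have rn0 : 0 < rn by rewrite exprn_gt0.
  by field; rewrite !gt_eqF.
apply: ler_pM => //.
- by rewrite mulr_ge0 ?sqr_ge0// divr_ge0 ?sqr_ge0// ltW.
- by rewrite ler_wpM2r// divr_ge0 ?sqr_ge0// ltW.
- by rewrite invf_le1 ?exprn_ege1// exprn_gt0// (lt_le_trans ltr01).
Qed.

(** The bound for one simplex and one [delta] passes to the infimum over [delta], then to the
    supremum over simplices. The product form covers [v = 0] as well. *)
Lemma beta_nb_mul_vol (B v b : R) : beta_nb n S x r = B%:E ->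
  max_simplex_vol n S x r = v%:E -> b_nb n S x r = b%:E ->
  B * v <= Num.sqrt (4 * plane_const n) * Num.sqrt b.
Proof.
move=> BE VE bE; have K0 : 0 < 4 * plane_const n :> R.
  by rewrite mulr_gt0// plane_const_gt0.
have B0 : 0 <= B by rewrite -lee_fin -BE beta_nb_ge0.
rewrite -sqrtrM ?(ltW K0)//.
have [B00|B00] := eqVneq B 0; first by rewrite B00 mul0r sqrtr_ge0.
have Bgt0 : 0 < B by rewrite lt_neqAle eq_sym B00.
rewrite mulrC -ler_pdivlMr//.
suff : (max_simplex_vol n S x r <=
    (Num.sqrt (4 * plane_const n * b) / B)%:E)%E by rewrite VE lee_fin.
apply/ereal_supP => _ [p Ap <-].
rewrite lee_fin ler_pdivlMr// mulrC.
apply: le_trans (ler_norm _) _; rewrite -sqrtr_sqr ler_wsqrtr//.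
rewrite [leRHS]mulrC -ler_pdivrMr//.
suff : (((B * (r ^- n * simplex_vol p)) ^+ 2 / (4 * plane_const n))%:E <=
    b_nb n S x r)%E by rewrite bE lee_fin.
apply: b_nb_ge => // delta f delta0 fi.
by rewrite ler_pdivrMr// [leRHS]mulrC; apply: beta_nb_isometry fi Ap.
Qed.

End Estimates.

Theorem proposition4p2 (R : realType) (n : nat) (n_gt0 : (0 < n)%N) :
  exists C : R, 0 < C /\
    forall (d : nat) (S : set 'rV[R]_d), (n < d)%N ->
      (forall (x : 'rV[R]_d) (r : R), S x -> 0 < r ->
        (beta_nb n S x r <=
           C%:E * mine (sqrt_quot (b_nb n S x r) (max_simplex_vol n S x r))
                       (max_simplex_vol n S x r `^ (n%:R^-1)))%E) /\
      (forall (x : 'rV[R]_d) (r : R), S x -> 0 < r ->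
        (alpha_nb n S x r < (8^-1)%:E)%E ->
        (beta_nb n S x r <= (100 * C)%:E * sqrte (b_nb n S x r))%E).
Proof.
pose K : R := Num.sqrt (4 * plane_const n).
pose c : R := 2^-1 ^+ n / n`!%:R.
have K0 : 0 <= K by exact: sqrtr_ge0.
have f0 : 0 < n`!%:R :> R by rewrite ltr0n fact_gt0.
have c0 : 0 < c by rewrite divr_gt0 ?exprn_gt0.
have Kc0 : 0 <= K / c by rewrite divr_ge0// ltW.
(* The summands serve, in order, the root bound, the quotient bound and the case of small alpha,
   where the volume is at least [c]. *)
exists (n`!%:R + K + K / c); split; first by lra.
move=> d S nd.
(* All three quantities are finite, which reduces the claims to inequalities between reals. *)
have fin x r : S x -> 0 < r -> exists B v b : R,
    [/\ beta_nb n S x r = B%:E, max_simplex_vol n S x r = v%:E,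
        b_nb n S x r = b%:E & 0 <= v].
  move=> Sx r0.
  have V0 := max_simplex_vol_ge0 n Sx r0; have Vy := max_simplex_vol_lty n S x r0.
  have Vfin : max_simplex_vol n S x r \is a fin_num by rewrite ge0_fin_numE.
  have bt := beta_nb_le_root n_gt0 nd Sx r0 (esym (fineK Vfin)).
  have btfin : beta_nb n S x r \is a fin_num.
    by rewrite ge0_fin_numE ?beta_nb_ge0//; apply: le_lt_trans bt (ltry _).
  have bfin : b_nb n S x r \is a fin_num.
    rewrite ge0_fin_numE ?b_nb_lty//; apply: b_nb_ge => // delta _ delta0 _.
    by rewrite divr_ge0// ltW.
  exists (fine (beta_nb n S x r)), (fine (max_simplex_vol n S x r)), (fine (b_nb n S x r)).
  by rewrite !fineK// fine_ge0.
split=> x r Sx r0.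
  have [B [v [b [BE VE bE v0]]]] := fin x r Sx r0.
  have Bv := beta_nb_mul_vol Sx r0 BE VE bE.
  have := beta_nb_le_root n_gt0 nd Sx r0 VE.
  rewrite BE VE bE lee_fin => Broot.
  have [_|_] := leP (sqrt_quot _ _) _.
    (* For zero volume the quotient is [+oo], and the right side is [+oo] since the constant is
       positive. *)
    rewrite /sqrt_quot; case: ifPn => [_|v_neq0].
      by rewrite gt0_muley ?leey// lte_fin; lra.
    have v1 : 0 < v by rewrite lt_neqAle eq_sym v0 andbT.
    rewrite inver (gt_eqF v1) /= -!EFinM lee_fin mulrA ler_pdivlMr//.
    apply: le_trans Bv _; rewrite ler_wpM2r ?sqrtr_ge0//; rewrite -/K; lra.
  rewrite poweR_EFin -EFinM lee_fin; apply: le_trans Broot _.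
  by rewrite ler_wpM2r ?powR_ge0//; lra.
move=> alpha8; have [B [v [b [BE VE bE v0]]]] := fin x r Sx r0.
have Bv := beta_nb_mul_vol Sx r0 BE VE bE.
have := alpha_nb_vol Sx r0 alpha8; rewrite VE lee_fin -/c => cv.
have B0 : 0 <= B by rewrite -lee_fin -BE beta_nb_ge0.
rewrite BE bE -EFinM lee_fin.
(* From [c <= v] and the product bound, [B * c <= B * v <= K * Num.sqrt b]. *)
have Bc : B <= K / c * Num.sqrt b.
  rewrite mulrAC ler_pdivlMr//; apply: le_trans Bv.
  by rewrite ler_wpM2l.
apply: le_trans Bc _; rewrite ler_wpM2r ?sqrtr_ge0//; lra.
Qed.
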